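(* For $k\ge 3$, the $k$-prism has injective chromatic number $4$ if and only if $k\not\equiv 0\pmod 3$.
   Context: The $k$-prism ($k\ge 3$) is the graph consisting of two $k$-cycles $u_0u_1\cdots u_{k-1}$ and $v_0v_1\cdots v_{k-1}$ together with the edges $u_iv_i$ for $0\le i\le k-1$. An injective $k$-colouring of a graph $G$ is a map $c:V(G)\to\{1,\dots,k\}$ such that any two distinct vertices with a common neighbour get different colours; the injective chromatic number $\chi_i(G)$ is the least such $k$. *)

(* Defs.v *)
From mathcomp Require Import all_boot.

Set Implicit Arguments.
Unset Strict Implicit.
Unset Printing Implicit Defensive.

(* A finite graph is given by its adjacency relation [e : rel T] on a finite
   vertex type; simple graphs are the symmetric and irreflexive relations. *)

Definition common_neighbour (T : finType) (e : rel T) (x y : T) : bool :=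
  [exists z, e x z && e y z].

Definition injective_colouring (T : finType) (e : rel T) (C : finType)
    (c : {ffun T -> C}) : bool :=
  [forall x, forall y, (x != y) && common_neighbour e x y ==> (c x != c y)].

(* The colours 1, ..., k are represented by the k elements of 'I_k. *)
Definition injectively_colourable (T : finType) (e : rel T) (k : nat) : bool :=
  [exists c : {ffun T -> 'I_k}, injective_colouring e c].

Lemma injectively_colourable_card (T : finType) (e : rel T) :
  exists k, injectively_colourable e k.
Proof.
exists #|T|; apply/existsP; exists [ffun x => enum_rank x].
apply/forallP=> x; apply/forallP=> y; apply/implyP=> /andP[neq_xy _].
by rewrite !ffunE (inj_eq enum_rank_inj).
Qed.

Definition injective_chromatic_number (T : finType) (e : rel T) : nat :=
  ex_minn (injectively_colourable_card e).

(* The vertex u_i is (false, i) and v_i is (true, i); [ordS] is the successor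
   modulo k. *)
Definition prism (k : nat) : rel (bool * 'I_k) := fun x y =>
  if x.1 == y.1 then (y.2 == ordS x.2) || (x.2 == ordS y.2) else x.2 == y.2.
Arguments prism : clear implicits.

Lemma prism_sym (k : nat) : symmetric (prism k).
Proof.
by move=> x y; rewrite /prism [y.1 == _]eq_sym [y.2 == x.2]eq_sym orbC.
Qed.

Lemma prism_irrefl (k : nat) : 1 < k -> irreflexive (prism k).
Proof.
move=> k_gt1 [b i]; rewrite /prism /= eqxx orbb; apply/negP=> /eqP/(congr1 val) /=.
have := ltn_ord i; rewrite leq_eqVlt => /predU1P[eq_i1k | lt_i1k].
  by rewrite eq_i1k modnn => i0; move: k_gt1; rewrite -eq_i1k i0.
by rewrite modn_small // => /n_Sn.
Qed.

(* Main.v *)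
(** Each vertex of a [d]-regular graph has exactly one neighbour of each colour
    in an injective [d]-colouring, so counting edges into a colour class gives
    [d %| #|V|]. For the prism [d = 3] and [#|V| = 2k], so three colours force
    [3 %| k]. Conversely, giving [u_i] and [v_i] the same colour [f i] is an
    injective colouring when any three cyclically consecutive values of [f]
    differ; such an [f] is the concatenation of blocks 012 and 0123 whenever
    [k] is of the form [3a + 4b]. Only [k = 5] is not, and it is coloured by
    hand. *)
Require Import Defs.
From mathcomp Require Import all_boot zify.

Set Implicit Arguments.
Unset Strict Implicit.
Unset Printing Implicit Defensive.

(** Equivalently, [c] is injective on the neighbourhood of each [z]. *)
Lemma injective_colouringP (T C : finType) (e : rel T) (c : {ffun T -> C}) :
  reflect (forall x y z, e x z -> e y z -> c x = c y -> x = y)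
          (injective_colouring e c).
Proof.
apply: (iffP forallP) => [cP x y z xz yz cxy | cP x].
  apply/eqP; apply: contraT => nxy.
  have /implyP := forallP (cP x) y; rewrite nxy cxy eqxx; apply.
  by apply/existsP; exists z; rewrite xz.
apply/forallP=> y; apply/implyP=> /andP[nxy /existsP[z /andP[xz yz]]].
by apply: contra nxy => /eqP cxy; apply/eqP; apply: cP xz yz cxy.
Qed.

Section RegularGraph.
Variables (T : finType) (e : rel T) (d : nat).
Hypothesis e_regular : forall z, #|[set x | e x z]| = d.

Lemma injective_colouring_card_image (C : finType) (c : {ffun T -> C}) z :
  injective_colouring e c -> #|c @: [set x | e x z]| = d.
Proof.
move=> /injective_colouringP cP; rewrite card_in_imset ?e_regular // => x y.
by rewrite !inE => xz yz; apply: cP xz yz.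
Qed.

Lemma injectively_colourable_ge (z : T) m : injectively_colourable e m -> d <= m.
Proof.
case/existsP=> c cP; rewrite -(injective_colouring_card_image z cP).
by rewrite -[X in _ <= X]card_ord max_card.
Qed.

Lemma injectively_colourable_dvdn :
  symmetric e -> 0 < d -> injectively_colourable e d -> d %| #|T|.
Proof.
move=> e_sym d_gt0 /existsP[c cP]; pose a := Ordinal d_gt0.
suff -> : #|T| = \sum_(x | c x == a) d by rewrite sum_nat_const dvdn_mull.
have one z : \sum_(x | c x == a) e x z = 1.
  have : a \in c @: [set x | e x z].
    (* The [d] neighbours of [z] carry [d] distinct colours, so every colour occurs among them. *)
    have /eqP -> : c @: [set x | e x z] == setT; last by rewrite inE.
    by rewrite eqEcard subsetT cardsT card_ord (injective_colouring_card_image z cP) /=.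
  case/imsetP=> x; rewrite inE => xz cx.
  rewrite (bigD1 x) -?cx //= xz big1 // => y /andP[/eqP cy /eqP nyx].
  apply/eqP; rewrite eqb0; apply/negP=> yz; apply: nyx.
  by move/injective_colouringP: cP => /(_ y x z yz xz); apply; rewrite cy cx.
(* Double count the adjacent pairs [(x, z)] with [c x = a], by [z] and then by [x]. *)
rewrite -sum1_card -(eq_bigr _ (fun z _ => one z)) exchange_big /=.
apply: eq_bigr => x _; rewrite -[RHS](e_regular x) -sum1_card [RHS]big_mkcond /=.
by apply: eq_bigr => z _; rewrite inE e_sym; case: (e z x).
Qed.

End RegularGraph.

Section Prism.
Variable k : nat.

(** Centring at [ordS j] allows the neighbours to be listed without [ord_pred]; every vertex has
    this form by [ord_predK]. *)
Lemma prism_ordS b (j : 'I_k) x :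
  prism k x (b, ordS j) =
  (x \in [:: (b, j); (~~ b, ordS j); (b, ordS (ordS j))]).
Proof.
case: x => a i; rewrite /prism !inE !xpair_eqE /= (inj_eq (@ordS_inj k)).
rewrite [j == i]eq_sym.
by case: a; case: b; rewrite /= ?orbF // orbC.
Qed.

Lemma ordSS_neq (i : 'I_k) : 2 < k -> i != ordS (ordS i).
Proof.
move=> k_gt2; rewrite -val_eqE /= -[_.+1 in X in _ != X]addn1 modnDml addn1.
by rewrite -{1}(modn_small (ltn_ord i)) -addn2 -{1}[val i]addn0 eqn_modDl mod0n modn_small.
Qed.

Lemma prism_regular z : 2 < k -> #|[set x | prism k x z]| = 3.
Proof.
case: z => b i k_gt2; rewrite -(ord_predK i); set j := ord_pred i.
pose s := [:: (b, j); (~~ b, ordS j); (b, ordS (ordS j))].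
have /card_uniqP s3 : uniq s.
  by rewrite /= !inE !xpair_eqE (negPf (ordSS_neq _ k_gt2)); case: (b).
rewrite -[RHS]/(size s) -s3; apply: eq_card => x.
by rewrite inE prism_ordS.
Qed.

Lemma prism_injectively_colourable m (g : bool * 'I_k -> 'I_m) :
  (forall b i, uniq [:: g (b, i); g (~~ b, ordS i); g (b, ordS (ordS i))]) ->
  injectively_colourable (prism k) m.
Proof.
move=> gP; apply/existsP; exists (finfun g); apply/injective_colouringP.
move=> x y [b i]; rewrite -(ord_predK i) !prism_ordS !ffunE.
have /and3P[] := gP b (ord_pred i).
rewrite !inE negb_or => /andP[/eqP ? /eqP ?] /eqP ? _.
by move=> /or3P[] /eqP-> /or3P[] /eqP-> // ?; congruence.
Qed.

(** The last two hypotheses are the windows that wrap past [k - 1]. With [f] on [nat], all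
    conditions become linear arithmetic. *)
Lemma prism_injectively_colourable_cyclic m (f : nat -> nat) :
    1 < k -> (forall i, f i < m) ->
    (forall i, i.+2 < k -> uniq [:: f i; f i.+1; f i.+2]) ->
    uniq [:: f k.-2; f k.-1; f 0] -> uniq [:: f k.-1; f 0; f 1] ->
  injectively_colourable (prism k) m.
Proof.
move=> k_gt1 f_lt fP fP2 fP1.
apply: (@prism_injectively_colourable _ (fun x => Ordinal (f_lt x.2))) => b i.
suff : uniq [:: f i; f (i.+1 %% k); f (i.+2 %% k)].
  by rewrite /= !inE -!val_eqE /= -[(i.+1 %% k).+1]addn1 modnDml addn1.
move: (nat_of_ord i) (ltn_ord i) => {}i lt_ik.
have [lt_i2k|] := ltnP i.+2 k; first by rewrite !modn_small ?fP // ltnW.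
rewrite leq_eqVlt => /predU1P[eq_ki2|lt_ki2].
  by rewrite -eq_ki2 modnn modn_small //; move: fP2; rewrite eq_ki2.
have eq_i1k : i.+1 = k by lia.
by rewrite eq_i1k modnn -[k.+1]addn1 modnDl modn_small //; move: fP1; rewrite -eq_i1k.
Qed.

Lemma prism_colourable3 : 2 < k -> 3 %| k -> injectively_colourable (prism k) 3.
Proof.
move=> k_gt2 k3.
apply: (@prism_injectively_colourable_cyclic _ (modn^~ 3)) => [|i|i _||];
  rewrite /= ?inE; lia.
Qed.

(** Blocks 012 followed by one final 0123. *)
Lemma prism_colourable4_mod1 :
  2 < k -> k %% 3 = 1 -> injectively_colourable (prism k) 4.
Proof.
move=> k_gt2 k1.
apply: (@prism_injectively_colourable_cyclic _
  (fun i => if i.+1 == k then 3 else i %% 3)) => [|i|i ltik||];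
  rewrite /= ?inE; do ?[case: ifP => ?]; lia.
Qed.

(** Here [k] is at least 8: blocks 012, then 0123 twice, with colour 3 at [k - 5] and [k - 1]. As
    [k - 4] is 1 modulo 3, the shift by 2 restarts the pattern at 0. *)
Lemma prism_colourable4_mod2 :
  5 < k -> k %% 3 = 2 -> injectively_colourable (prism k) 4.
Proof.
move=> k_gt5 k2.
apply: (@prism_injectively_colourable_cyclic _
  (fun i => if (i.+1 == k) || (i + 5 == k) then 3
            else if i + 5 < k then i %% 3 else (i + 2) %% 3)) => [|i|i ltik||];
  rewrite /= ?inE; do ?[case: ifP => ?]; lia.
Qed.

End Prism.

(* [C_10^2] coloured 0120120123: its vertex [j] is [u_(j mod 5)] for [j] even
   and [v_(j mod 5)] for [j] odd, and these are all vertices by the Chinese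
   remainder theorem. *)
Lemma prism5_colourable4 : injectively_colourable (prism 5) 4.
Proof.
pose g (x : bool * 'I_5) : 'I_4 :=
  inord (nth 0 (if x.1 then [:: 2; 1; 1; 0; 3] else [:: 0; 0; 2; 2; 1]) x.2).
apply: (@prism_injectively_colourable _ _ g) => b i.
rewrite /= !inE -!val_eqE /g.
by case: b; case: i => [[|[|[|[|[|]]]]] ?] //=; rewrite !inordK.
Qed.

Lemma prism_colourable4 k :
  3 <= k -> ~~ (3 %| k) -> injectively_colourable (prism k) 4.
Proof.
move=> k_ge3 k3; have [k1|k1] := eqVneq (k %% 3) 1.
  by apply: prism_colourable4_mod1 => //; lia.
have [->|k5] := eqVneq k 5; first exact: prism5_colourable4.
by apply: prism_colourable4_mod2; lia.
Qed.

Theorem theorem14 (k : nat) (hk : 3 <= k) :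
  injective_chromatic_number (prism k) = 4 <-> k <> 0 %[mod 3].
Proof.
have reg z := prism_regular z hk.
rewrite /injective_chromatic_number; case: ex_minnP => m col_m min_m.
split=> [m4 /eqP k3 | /eqP k3].
  by have := min_m 3 (prism_colourable3 hk k3); rewrite m4.
have m_ge3 := injectively_colourable_ge reg (false, Ordinal (ltnW (ltnW hk))) col_m.
have m_le4 := min_m 4 (prism_colourable4 hk k3).
suff : m != 3 by lia.
apply/eqP=> m3; rewrite m3 in col_m.
(* 3 divides [2 * k] and is coprime to 2, so it would divide [k]. *)
have := injectively_colourable_dvdn reg (@prism_sym k) isT col_m.
by rewrite card_prod card_bool card_ord Gauss_dvdr //; apply/negP.
Qed.
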